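(* Consider the operator splitting scheme described in the context for the reaction-diffusion system with one reversible reaction. Given $c^n$ with $c^n_{i,j,k}\in\mathbb{R}^N_+$ (all components positive) for all $0\le i,j,k\le N_0-1$, with periodic boundary conditions, the scheme has a unique solution $c^{n+1}$, and $c^{n+1}_{i,j,k}\in\mathbb{R}^N_+$ for all $0\le i,j,k\le N_0-1$. Moreover $\mathcal{F}_h(c^{n+1})\le\mathcal{F}_h(c^n)$, and hence $\mathcal{F}_h(c^n)\le\mathcal{F}_h(c^0)$ for all $n$.
   Context: Species $X_1,\dots,X_N$ undergo one reaction with stoichiometric vector $\sigma=(-\alpha_1,\dots,-\alpha_r,\beta_{r+1},\dots,\beta_N)^{\rm T}$, $1\le r<N$, $\alpha_i,\beta_i>0$; $U_1,\dots,U_N\in\mathbb{R}$, $k_1^->0$. Periodic grid on $(0,1)^3$, $h=1/N_0$, $\langle f,g\rangle=h^3\sum_{i,j,k}f_{i,j,k}g_{i,j,k}$, and $\mathcal{F}_h(c)=\langle\sum_{i=1}^N(c_i(\ln c_i-1)+c_iU_i),\mathbf 1\rangle$. Reaction scheme with step $\tau$ at a single grid point, starting from $c^0>0$: with $c(R)=c^0+\sigma R$, $F(R)=\sum_i[c_i(R)(\ln c_i(R)-1)+c_i(R)U_i]$, $\mu_i(R)=\ln c_i(R)+U_i$, $\eta(c)=k_1^-\prod_{i>r}c_i^{\beta_i}$, $\phi(p,q)=\frac{F(p)-F(q)}{p-q}$ ($p\ne q$), $\phi(p,p)=F'(p)$: first compute the predictor $\widehat R$ with $c(\widehat R)>0$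 solving $\ln\big(\frac{\widehat R}{\eta(c^0)\tau}+1\big)=-\sum_i\sigma_i\mu_i(\widehat R)$; with $\hat\eta=\eta(c(\widehat R/2))$, find $R$ with $c(R)>0$, $R+\hat\eta\tau>0$ and $\ln\big(\frac{R}{\hat\eta\tau}+1\big)=-\phi(R,0)-\tau\sum_i\sigma_i(\mu_i(R)-\mu_i(0))$; output $c^0+\sigma R$. Diffusion schemes with step $\tau$ for each species separately ($\partial_t c_i=\nabla\cdot(D_i(c_i)\nabla c_i)$, $D_i>0$): if $D_i$ is a constant, $c_i\mapsto e^{D_i\tau\Delta_h}c_i$ with $\Delta_h$ the periodic 7-point discrete Laplacian; otherwise, from $\rho^n=c_i$, compute the positive solution $\hat\rho$ of $\frac{\hat\rho-\rho^n}{\tau}=\nabla_h\cdot(\mathcal{A}_h[D_i(\rho^n)]\nabla_h\hat\rho)$, set $\hat\rho^{1/2}=\frac12(\rho^n+\hat\rho)$, $\mathcal{M}=\mathcal{A}_h(D_i(\hat\rho^{1/2})\hat\rho^{1/2})$, and find positive $\rho^{n+1}$ with $\frac{\rho^{n+1}-\rho^n}{\tau}=\nabla_h\cdot(\mathcal{M}\nabla_h\mu)$, $\mu=Q(\rho^{n+1},\rho^n)+\tau(\ln\rho^{n+1}-\ln\rho^n)$, where $Q(p,q)=\frac{F_i(p)-F_i(q)}{p-q}$ ($p\neq q$), $Q(p,p)=F_i'(p)$, $F_i(\rho)=\rho(\ln\rho-1)+U_i\rho$; here $\nabla_h$ is the forward difference to staggered points, $\nabla_h\cdot$ the backward-difference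 divergence, $\mathcal{A}_h$ the two-point average to staggered points. Splitting step ($\Delta t>0$): Stage 1: apply the reaction scheme with $\tau=\Delta t/2$ at every grid point to $c^n$, giving $c^{n+1,(1)}$. Stage 2: apply the diffusion scheme with $\tau=\Delta t$ to each species of $c^{n+1,(1)}$, giving $c^{n+1,(2)}$. Stage 3: apply the reaction scheme with $\tau=\Delta t/2$ at every grid point to $c^{n+1,(2)}$, giving $c^{n+1}$. *)

(* Defs.v *)
From HB Require Import structures.
From mathcomp Require Import all_boot all_order all_algebra.
From mathcomp Require Import all_classical all_reals all_analysis.
Set Implicit Arguments. Unset Strict Implicit. Unset Printing Implicit Defensive.
Import Order.TTheory GRing.Theory Num.Theory numFieldNormedType.Exports.
Local Open Scope ring_scope.

Definition pt (N0 : nat) : Type := ('I_N0 * 'I_N0 * 'I_N0)%type.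

Definition fwd (N0 : nat) (d : 'I_3) (p : pt N0) : pt N0 :=
  match val d with
  | 0%N => (ordS p.1.1, p.1.2, p.2)
  | 1%N => (p.1.1, ordS p.1.2, p.2)
  | _ => (p.1.1, p.1.2, ordS p.2)
  end.
Definition bwd (N0 : nat) (d : 'I_3) (p : pt N0) : pt N0 :=
  match val d with
  | 0%N => (ord_pred p.1.1, p.1.2, p.2)
  | 1%N => (p.1.1, ord_pred p.1.2, p.2)
  | _ => (p.1.1, p.1.2, ord_pred p.2)
  end.

Definition hstep (R : realType) (N0 : nat) : R := (N0%:R)^-1.

Definition gdot (R : realType) (N0 : nat) (f g : pt N0 -> R) : R :=
  hstep R N0 ^+ 3 * \sum_(p : pt N0) f p * g p.

Definition lap (R : realType) (N0 : nat) (u : pt N0 -> R) : pt N0 -> R :=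
  fun p => \sum_(d < 3) (u (fwd d p) + u (bwd d p) - 2 * u p) / hstep R N0 ^+ 2.

(* nabla_h . (A_h[f] nabla_h u): forward difference to staggered points,
   two-point average A_h of f to staggered points, backward-difference divergence *)
Definition divAgrad (R : realType) (N0 : nat) (f u : pt N0 -> R) : pt N0 -> R :=
  fun p => \sum_(d < 3)
    ( (f p + f (fwd d p)) / 2 * ((u (fwd d p) - u p) / hstep R N0)
    - (f (bwd d p) + f p) / 2 * ((u p - u (bwd d p)) / hstep R N0) ) / hstep R N0.

Definition expLap (R : realType) (N0 : nat) (a : R) (u : pt N0 -> R) : pt N0 -> R :=
  fun p => limn (series (fun k : nat => a ^+ k / (k`!)%:R * iter k (@lap R N0) u p)).

Definition Fh (R : realType) (N : nat) (N0 : nat) (U : 'I_N -> R)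
    (c : 'I_N -> pt N0 -> R) : R :=
  gdot (fun p => \sum_(i < N) (c i p * (ln (c i p) - 1) + c i p * U i)) (fun _ => 1).

(* sigma : stoichiometric vector (sigma_i = -alpha_i for i < r, = beta_i for i >= r) *)

Definition cR (R : realType) (N : nat) (sigma : 'I_N -> R) (c0 : 'I_N -> R) (x : R)
  : 'I_N -> R := fun i => c0 i + sigma i * x.

Definition Freac (R : realType) (N : nat) (sigma U : 'I_N -> R) (c0 : 'I_N -> R)
  (x : R) : R :=
  \sum_(i < N) (cR sigma c0 x i * (ln (cR sigma c0 x i) - 1) + cR sigma c0 x i * U i).

Definition mu (R : realType) (N : nat) (sigma U : 'I_N -> R) (c0 : 'I_N -> R)
  (x : R) (i : 'I_N) : R := ln (cR sigma c0 x i) + U i.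

(* eta(c) = k1^- prod_{i > r} c_i^{beta_i}; products are indices i >= r (0-based) *)
Definition eta (R : realType) (N r : nat) (sigma : 'I_N -> R) (km : R)
  (c : 'I_N -> R) : R :=
  km * \prod_(i < N | (r <= i)%N) (c i `^ sigma i).

Definition phi (R : realType) (F : R -> R) (p q : R) : R :=
  if p == q then derive1 F p else (F p - F q) / (p - q).

Definition react_pred (R : realType) (N r : nat) (sigma U : 'I_N -> R) (km tau : R)
  (c0 : 'I_N -> R) (Rh : R) : Prop :=
  (forall i, 0 < cR sigma c0 Rh i) /\
  0 < Rh + eta r sigma km c0 * tau /\
  ln (Rh / (eta r sigma km c0 * tau) + 1)
    = - \sum_(i < N) sigma i * mu sigma U c0 Rh i.

Definition react_corr (R : realType) (N r : nat) (sigma U : 'I_N -> R) (km tau : R)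
  (c0 : 'I_N -> R) (Rh x : R) : Prop :=
  let etah := eta r sigma km (cR sigma c0 (Rh / 2)) in
  (forall i, 0 < cR sigma c0 x i) /\
  0 < x + etah * tau /\
  ln (x / (etah * tau) + 1)
    = - phi (Freac sigma U c0) x 0
      - tau * \sum_(i < N) sigma i * (mu sigma U c0 x i - mu sigma U c0 0 i).

Definition react_step (R : realType) (N r : nat) (sigma U : 'I_N -> R) (km tau : R)
  (c0 cout : 'I_N -> R) : Prop :=
  exists Rh x, react_pred r sigma U km tau c0 Rh /\
    react_corr r sigma U km tau c0 Rh x /\ cout = cR sigma c0 x.

Definition react_field (R : realType) (N r N0 : nat) (sigma U : 'I_N -> R) (km tau : R)
  (c cout : 'I_N -> pt N0 -> R) : Prop :=
  forall p : pt N0, react_step r sigma U km tau (fun i => c i p) (fun i => cout i p).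

Definition D_const (R : realType) (D : R -> R) : Prop :=
  exists d : R, forall x, 0 < x -> D x = d.

Definition Fsp (R : realType) (Ui : R) (rho : R) : R := rho * (ln rho - 1) + Ui * rho.
Definition Q (R : realType) (Ui : R) (p q : R) : R := phi (Fsp Ui) p q.

Definition diff_pred (R : realType) (N0 : nat) (D : R -> R) (tau : R)
  (rho rhoh : pt N0 -> R) : Prop :=
  (forall p, 0 < rhoh p) /\
  forall p, (rhoh p - rho p) / tau = divAgrad (fun q => D (rho q)) rhoh p.

Definition diff_corr (R : realType) (N0 : nat) (D : R -> R) (Ui tau : R)
  (rho rhoh rho' : pt N0 -> R) : Prop :=
  let half := fun q => (rho q + rhoh q) / 2 in
  let muv := fun q => Q Ui (rho' q) (rho q) + tau * (ln (rho' q) - ln (rho q)) in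
  (forall p, 0 < rho' p) /\
  forall p, (rho' p - rho p) / tau = divAgrad (fun q => D (half q) * half q) muv p.

Definition diff_step (R : realType) (N0 : nat) (D : R -> R) (Ui tau : R)
  (rho rho' : pt N0 -> R) : Prop :=
  (forall d, (forall x, 0 < x -> D x = d) -> rho' = expLap (d * tau) rho) /\
  (~ D_const D -> exists rhoh, diff_pred D tau rho rhoh /\ diff_corr D Ui tau rho rhoh rho').

Definition split_step (R : realType) (N r N0 : nat) (sigma U : 'I_N -> R) (km : R)
  (D : 'I_N -> R -> R) (dt : R) (c cnext : 'I_N -> pt N0 -> R) : Prop :=
  exists c1 c2 : 'I_N -> pt N0 -> R,
    react_field r sigma U km (dt / 2) c c1 /\
    (forall i, diff_step (D i) (U i) dt (c1 i) (c2 i)) /\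
    react_field r sigma U km (dt / 2) c2 cnext.

(* Main.v *)
(** Reaction.  Up to a nondecreasing continuous function of the unknown R, both reaction equations
    have the form  sum_j w_j s_j ln (c_j + s_j R) = const  over the N species and one fictitious
    species with concentration eta tau + R.  The left side is strictly increasing and runs from
    -oo to +oo on the interval where all the logarithms are defined, because both signs of s_j
    occur.  Multiplying the corrector equation by R gives F(R) - F(0) <= 0.

    Variable diffusion.  Predictor and corrector are  v - tau div (w grad g(v)) = rho  with g
    increasing at every grid point.  This system is quasimonotone, so Perron's method between
    the sub- and supersolutions on which g is constant gives existence, and comparison gives
    uniqueness.  Energy decay is summation by parts.

    Constant diffusion.  exp (a Lap) u is the limit of (1 + (a/n) Lap)^n u.  For large n each factor
    is an average with doubly stochastic weights, so it preserves lower bounds and, by Jensen,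
    decreases the energy; both properties pass to the limit. *)
Require Import Defs.
From HB Require Import structures.
From mathcomp Require Import all_boot all_order all_algebra.
From mathcomp Require Import all_classical all_reals all_analysis.
From mathcomp Require Import ring lra.
Import Order.TTheory GRing.Theory Num.Theory numFieldNormedType.Exports.
Local Open Scope ring_scope.
Set Implicit Arguments. Unset Strict Implicit. Unset Printing Implicit Defensive.

(** * Quasimonotone systems *)

(* Perron's method: the pointwise supremum of the subsolutions between lo and hi is a solution. *)
Lemma quasimonotone_root (R : realType) (I : eqType) (E : (I -> R) -> I -> R)
    (lo hi : I -> R) :
  (forall p, lo p <= hi p) ->
  (forall u v p, (forall q, lo q <= u q) -> (forall q, u q <= v q) ->
     u p = v p -> E v p <= E u p) ->
  (forall u p t, (forall q, lo q <= u q) -> lo p <= t ->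
     {for t, continuous (fun s => E [eta u with p |-> s] p)}) ->
  (forall p, E lo p <= 0) -> (forall p, 0 <= E hi p) ->
  exists u, (forall q, lo q <= u q) /\ forall p, E u p = 0.
Proof.
move=> lohi Emono Econt Elo Ehi.
pose S := [set u : I -> R | (forall q, lo q <= u q <= hi q) /\ forall p, E u p <= 0]%classic.
have Slo : S lo by split => // q; rewrite lexx lohi.
pose ps p := [set u p | u in S]%classic.
pose us p := sup (ps p).
have ps0 p : (ps p !=set0)%classic by exists (lo p), lo.
have psub p : ubound (ps p) (hi p) by move=> _ [u [ub _] <-]; have /andP[] := ub p.
have pssup p : has_sup (ps p) by split => //; exists (hi p).
have us_ge u p : S u -> u p <= us p.
  by move=> Su; apply: ub_le_sup; [exists (hi p) | exists u].
have lous p : lo p <= us p by exact: us_ge.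
have ushi p : us p <= hi p by apply: ge_sup.
have usp p : us = [eta us with p |-> us p].
  by apply/funext => q /=; case: eqP => [->|].
(* If [E us p > 0], continuity keeps [E] positive when the value at [p] is lowered slightly; a
   member of [S] that comes that close to the supremum at [p] then contradicts [Emono]. *)
have Eus p : E us p <= 0.
  rewrite leNgt; apply/negP => Epos.
  have ct := Econt us p (us p) lous (lous p).
  rewrite {1}(usp p) in Epos.
  have [e e0 he] : exists2 e, 0 < e & forall t, `|us p - t| < e -> 0 < E [eta us with p |-> t] p.
    have : \forall t \near us p, 0 < E [eta us with p |-> t] p by apply: (cvgr_gt _ ct).
    move=> /nbhs_normP[e /= e0 he].
    by exists e => // t ht; apply: he; rewrite /=.
  have [_ [u Su <-] hu] := sup_adherent e0 (pssup p).
  have := us_ge u p Su => uple.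
  have := he (u p); rewrite -/(us p) in hu; rewrite ger0_norm ?subr_ge0 // ltrBlDr -ltrBlDl.
  move=> /(_ hu); apply/negP; rewrite -leNgt.
  apply: (le_trans _ (Su.2 p)); apply: Emono => /= [q|q|].
  - by have /andP[] := Su.1 q.
  - by case: eqP => [->//|_]; apply: us_ge.
  - by rewrite eqxx.
exists us; split => // p; apply/eqP; rewrite eq_le Eus /= leNgt; apply/negP => Eneg.
(* At a contact point with [hi], quasimonotonicity would transfer [0 <= E hi p] to [us]. *)
have uship : us p < hi p.
  rewrite lt_neqAle ushi andbT; apply/eqP => E1.
  by have := le_lt_trans (Emono us hi p lous ushi E1) Eneg; rewrite ltNge Ehi.
have ct := Econt us p (us p) lous (lous p).
rewrite {1}(usp p) in Eneg.
have : \forall t \near us p, E [eta us with p |-> t] p < 0 by apply: (cvgr_lt _ ct).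
move=> /nbhs_normP[e /= e0 he].
(* Raising [us] to [t] at [p] alone stays below [hi] and remains a subsolution: at [p] by the choice
   of [e], elsewhere because raising another coordinate can only lower [E]. This exceeds the
   supremum. *)
pose t := Num.min (hi p) (us p + e / 2).
have ust : us p < t by rewrite lt_min uship ltrDl divr_gt0.
have : S [eta us with p |-> t].
  split => q /=.
    case: eqP => [->|_]; last by rewrite lous ushi.
    by rewrite (le_trans (lous p) (ltW ust)) ge_min lexx.
  have [->|qp] := eqVneq q p.
    apply: ltW; apply: he; rewrite /= distrC ger0_norm ?subr_ge0 1?ltW //.
    by rewrite ltrBlDl gt_min ltrD2l gtr_pMr // invf_lt1 // ltr1n orbT.
  apply: (le_trans _ (Eus q)); apply: Emono => //= [q'|].
    by case: eqP => // ->; apply: ltW.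
  by rewrite (negbTE qp).
by move/(us_ge _ p); rewrite /= eqxx leNgt ust.
Qed.

(** * Difference quotients of convex functions *)

Section slope.
Variables (R : realType) (J : R -> Prop) (F G : R -> R).
Hypothesis F_above_tangent : forall x y, J x -> J y -> F x + G x * (y - x) <= F y.
Hypothesis dF : forall x, J x -> is_derive x 1 F (G x).

Lemma phi_diag x : J x -> phi F x x = G x.
Proof. by move=> Jx; rewrite /phi eqxx derive1E; have [_ ->] := dF Jx. Qed.

Lemma phiM x y : phi F x y * (x - y) = F x - F y.
Proof.
rewrite /phi; case: eqVneq => [->|xy]; first by rewrite !subrr mulr0.
by rewrite divfK // subr_eq0.
Qed.

(** Chord slopes of a convex function increase, convexity being given by the tangent inequality. If
    [q] lies between [x] and [y], [G q] separates the two slopes; otherwise the tangent at the point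
    nearer to [q] does the comparison. *)
Lemma phi_le q x y : J q -> J x -> J y -> x <= y -> phi F x q <= phi F y q.
Proof.
move=> Jq Jx Jy xy.
have [<-//|xy'] := eqVneq x y.
have {xy xy'} xy : x < y by rewrite lt_neqAle xy' xy.
have sx := phiM x q; have sy := phiM y q.
have := F_above_tangent Jx Jy; have := F_above_tangent Jy Jx.
have := F_above_tangent Jq Jx; have := F_above_tangent Jx Jq.
have := F_above_tangent Jq Jy; have := F_above_tangent Jy Jq.
have Dx := @phi_diag x Jx; have Dq := @phi_diag q Jq.
move: (F x) (F y) (F q) (G x) (G y) (G q) sx sy Dq => fx fy fq gx gy gq sx sy Dq h1 h2 h3 h4 h5 h6.
case: (ltgtP q x) sx => [qx|xq|qx] sx.
- have px : phi F x q <= gx by rewrite -(@ler_pM2r _ (x - q)) ?subr_gt0 // sx; lra.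
  have qy : 0 < y - q by lra.
  rewrite -(@ler_pM2r _ (y - q)) // sy; nra.
- case: (ltgtP q y) sy => [qy|yq|qy] sy.
  + have : phi F x q <= gq by rewrite -(@ler_nM2r _ (x - q)) ?subr_lt0 // sx; lra.
    move=> /le_trans; apply; rewrite -(@ler_pM2r _ (y - q)) ?subr_gt0 // sy; lra.
  + have py : gy <= phi F y q by rewrite -(@ler_nM2r _ (y - q)) ?subr_lt0 // sy; lra.
    have qx : x - q < 0 by lra.
    rewrite -(@ler_nM2r _ (x - q)) // sx; nra.
  + rewrite -qy Dq -(@ler_nM2r _ (x - q)) ?subr_lt0 // sx; lra.
- rewrite -qx Dq -(@ler_pM2r _ (y - q)) ?subr_gt0 // ?qx // -qx sy; lra.
Qed.

(** On the diagonal, [phi F ^~ q] is exactly the continuous function of Caratheodory's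
    characterization of the derivative at [q]; off the diagonal it is locally a quotient of
    continuous functions. *)
Lemma phi_continuous q x : J q -> J x -> {for x, continuous (phi F ^~ q)}.
Proof.
move=> Jq Jx; have [->|xq] := eqVneq x q.
  have /is_derive1_caratheodory[g [gE cg gq]] := dF Jq.
  suff -> : phi F ^~ q = g by [].
  apply/funext => z; have [->|zq] := eqVneq z q; first by rewrite phi_diag.
  by apply: (@mulIf _ (z - q)); rewrite ?subr_eq0 // phiM gE.
have cF : {for x, continuous F}.
  by apply: differentiable_continuous; apply/derivable1_diffP; have [] := dF Jx.
have cs : {for x, continuous (fun z => (F z - F q) / (z - q))}.
  apply: cvgM; first by apply: cvgB => //; exact: cvg_cst.
  apply: cvgV; first by rewrite subr_eq0.
  by apply: cvgB; [exact: cvg_id | exact: cvg_cst].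
have phixq : phi F x q = (F x - F q) / (x - q) by rewrite /phi (negbTE xq).
have : (phi F z q @[z --> x] --> phi F x q)%classic.
  have nq : \forall z \near x, z != q.
    by apply: (@open_nbhs_nbhs _ _ [set z | z != q]%classic); split => //; exact: open_neq.
  rewrite phixq; apply: cvg_trans cs; apply: near_eq_cvg; near=> z.
  rewrite /phi ifN //; near: z.
by [].
Unshelve. all: by end_near.
Qed.

End slope.

(** * Discrete calculus on the periodic grid *)

Lemma fwdK (N0 : nat) (d : 'I_3) : cancel (@fwd N0 d) (@bwd N0 d).
Proof.
by move=> [[i j] k]; rewrite /fwd /bwd; case: (val d) => [|[|m]] /=; rewrite ordSK.
Qed.

Lemma bwdK (N0 : nat) (d : 'I_3) : cancel (@bwd N0 d) (@fwd N0 d).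
Proof.
by move=> [[i j] k]; rewrite /fwd /bwd; case: (val d) => [|[|m]] /=; rewrite ord_predK.
Qed.

Section grid.
Variables (R : realType) (N0 : nat).
Implicit Types (u v w : pt N0 -> R) (p : pt N0).
Hypothesis N0_gt0 : (0 < N0)%N.

Lemma hstep_gt0 : 0 < hstep R N0.
Proof. by rewrite invr_gt0 ltr0n. Qed.

Lemma sum_fwd d u : \sum_p u (fwd d p) = \sum_p u p.
Proof.
rewrite [RHS](reindex (fwd d)) //.
by exists (bwd d) => p _; rewrite ?fwdK ?bwdK.
Qed.

Lemma sum_bwd d u : \sum_p u (bwd d p) = \sum_p u p.
Proof.
rewrite [RHS](reindex (bwd d)) //.
by exists (fwd d) => p _; rewrite ?fwdK ?bwdK.
Qed.

(** Neighbouring values enter the divergence at [p] with nonnegative coefficients; this is the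
    source of quasimonotonicity. *)
Lemma divAgrad_le w u v p :
  (forall q, 0 <= w q) -> (forall q, u q <= v q) -> u p = v p ->
  divAgrad w u p <= divAgrad w v p.
Proof.
move=> w0 uv uvp; apply: ler_sum => d _.
have h0 : 0 < (hstep R N0)^-1 by rewrite invr_gt0 hstep_gt0.
rewrite ler_pM2r // uvp; apply: lerB.
  by rewrite ler_wpM2l ?divr_ge0 ?addr_ge0 // ler_pM2r // lerD2r.
by rewrite ler_wpM2l ?divr_ge0 ?addr_ge0 // ler_pM2r // lerD2l lerN2.
Qed.

Lemma divAgradB w u v p :
  divAgrad w (fun q => u q - v q) p = divAgrad w u p - divAgrad w v p.
Proof. by rewrite /divAgrad -sumrB; apply: eq_bigr => d _; ring. Qed.

Lemma divAgrad_cst w (a : R) p : divAgrad w (fun=> a) p = 0.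
Proof. by rewrite /divAgrad big1 // => d _; rewrite subrr !(mul0r, mulr0) subrr mul0r. Qed.

Lemma sum_divAgrad_le0 w u : (forall q, 0 <= w q) -> \sum_p u p * divAgrad w u p <= 0.
Proof.
move=> w0; have h0 := hstep_gt0; set h := hstep R N0 in h0.
rewrite /divAgrad -/h; under eq_bigr do rewrite mulr_sumr.
rewrite exchange_big /=; apply: sumr_le0 => d _.
(* [e p] is the flux across the face between [p] and [fwd d p], divided by [h]. The second flux in
   the divergence is [e (bwd d p)], so a shift of its sum pairs [u p - u (fwd d p)] with [e p]. *)
pose e p := (w p + w (fwd d p)) / 2 * ((u (fwd d p) - u p) / h) / h.
have E p : (u p * (((w p + w (fwd d p)) / 2 * ((u (fwd d p) - u p) / h)
    - (w (bwd d p) + w p) / 2 * ((u p - u (bwd d p)) / h)) / h))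
    = u p * e p - u p * e (bwd d p).
  by rewrite /e bwdK; ring.
under eq_bigr do rewrite E.
rewrite sumrB; rewrite -(sum_fwd d (fun p => u p * e (bwd d p))) -sumrB.
apply: sumr_le0 => p _; rewrite fwdK /e.
set a := u p; set b := u _.
have -> : a * ((w p + w (fwd d p)) / 2 * ((b - a) / h) / h)
   - b * ((w p + w (fwd d p)) / 2 * ((b - a) / h) / h)
   = - ((w p + w (fwd d p)) / 2 * ((b - a) / h) ^+ 2) by ring.
by rewrite oppr_le0 mulr_ge0 ?sqr_ge0 // divr_ge0 // addr_ge0.
Qed.

Lemma sum_lap u : \sum_p lap u p = 0.
Proof.
rewrite /lap exchange_big /= big1 // => d _.
by rewrite -mulr_suml sumrB big_split /= sum_fwd sum_bwd -mulr_sumr; ring.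
Qed.

Lemma exists_max (f : pt N0 -> R) : exists p, forall q, f q <= f p.
Proof.
pose z := Ordinal N0_gt0.
have [p _ hp] := arg_maxP (P := predT) f (erefl (predT ((z, z, z) : pt N0))).
by exists p => q; apply: hp.
Qed.

Lemma exists_min (f : pt N0 -> R) : exists p, forall q, f p <= f q.
Proof.
by have [p hp] := exists_max (fun q => - f q); exists p => q; rewrite -lerN2.
Qed.

(** * A monotone nonlinear diffusion equation *)

Section nonlinear_diffusion.
Variables (w : pt N0 -> R) (g : pt N0 -> R -> R) (rho : pt N0 -> R) (tau : R).
Hypothesis w_ge0 : forall p, 0 <= w p.
Hypothesis tau_gt0 : 0 < tau.
Hypothesis rho_gt0 : forall p, 0 < rho p.
Hypothesis g_lt : forall p x y, 0 < x -> x < y -> g p x < g p y.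
Hypothesis g_cont : forall p x, 0 < x -> {for x, continuous (g p)}.
Hypothesis g_range : forall p q, exists2 t, 0 < t & g p t = g q (rho q).

Let g_le p x y : 0 < x -> x <= y -> g p x <= g p y.
Proof. by move=> x0; rewrite le_eqVlt => /predU1P[->//|/(g_lt p x0)/ltW]. Qed.

Let g_le_inv p x y : 0 < x -> 0 < y -> g p x <= g p y -> x <= y.
Proof. by move=> x0 y0; apply: contraTT; rewrite -!ltNge; apply: g_lt. Qed.

(** Covers both stages: the predictor has the identity for [g], the corrector has the regularized
    chemical potential, which depends on the grid point through the old density. *)
Definition diffusion_eq (v : pt N0 -> R) : Prop :=
  (forall p, 0 < v p) /\
  forall p, (v p - rho p) / tau = divAgrad w (fun q => g q (v q)) p.

(* Comparison principle: evaluate at the maximum of g(u) - g(v). *)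
Let diffusion_le u v : diffusion_eq u -> diffusion_eq v -> forall p, u p <= v p.
Proof.
move=> [u0 Eu] [v0 Ev].
have [p hp] := exists_max (fun q => g q (u q) - g q (v q)).
suff hle : g p (u p) <= g p (v p).
  move=> q; apply: (@g_le_inv q) => //.
  by rewrite -subr_le0 (le_trans (hp q)) // subr_le0.
have uvp : u p <= v p.
  have : divAgrad w (fun q => g q (u q) - g q (v q)) p <= 0.
    rewrite -(@divAgrad_cst w (g p (u p) - g p (v p)) p).
    exact: divAgrad_le.
  rewrite divAgradB -Eu -Ev -mulrBl pmulr_lle0 ?invr_gt0 //; lra.
exact: g_le.
Qed.

Lemma diffusion_unique u v : diffusion_eq u -> diffusion_eq v -> u = v.
Proof.
by move=> hu hv; apply/funext => p; apply/eqP; rewrite eq_le !diffusion_le.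
Qed.

(* Sub- and supersolutions on which g takes the constant values min/max of g(rho). *)
Lemma diffusion_exists : exists v, diffusion_eq v.
Proof.
have [p1 h1] := exists_min (fun q => g q (rho q)).
have [p2 h2] := exists_max (fun q => g q (rho q)).
have [lo lo0 glo] : exists2 lo, (forall p, 0 < lo p) & forall p, g p (lo p) = g p1 (rho p1).
  have /choice[f hf] : forall p, exists t, 0 < t /\ g p t = g p1 (rho p1).
    by move=> p; have [t] := g_range p p1; exists t.
  by exists f => p; have [] := hf p.
have [hi hi0 ghi] : exists2 hi, (forall p, 0 < hi p) & forall p, g p (hi p) = g p2 (rho p2).
  have /choice[f hf] : forall p, exists t, 0 < t /\ g p t = g p2 (rho p2).
    by move=> p; have [t] := g_range p p2; exists t.
  by exists f => p; have [] := hf p.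
have lorho p : lo p <= rho p by apply: (@g_le_inv p) => //; rewrite glo.
have rhohi p : rho p <= hi p by apply: (@g_le_inv p) => //; rewrite ghi.
pose E (v : pt N0 -> R) p := (v p - rho p) / tau - divAgrad w (fun q => g q (v q)) p.
have [|u v p lou uv uvp|u p t lou lot|p|p|v [lov Ev]] := @quasimonotone_root R _ E lo hi.
- by move=> p; apply: le_trans (rhohi p).
- rewrite /E uvp lerB // divAgrad_le // => [q|]; last by rewrite uvp.
  by apply: g_le => //; apply: lt_le_trans (lou q).
- have t0 : 0 < t by apply: lt_le_trans lot.
  have cg q : {for t, continuous (fun s : R => g q ([eta u with p |-> s] q))}.
    rewrite /=; case: eqP => [->|_]; last exact: cvg_cst.
    exact: g_cont.
  have cw (a : R) : {for t, continuous (fun s : R => a : R)} by exact: cvg_cst.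
  rewrite /E; apply: cvgB.
    apply: cvgM; last exact: cw.
    by rewrite /= eqxx; apply: cvgB; [exact: cvg_id | exact: cw].
  apply: cvg_big => [|d _]; first exact: add_continuous.
  apply: cvgM; last exact: cw.
  apply: cvgB; apply: cvgM; try exact: cw.
    by apply: cvgM; [apply: cvgB; apply: cg | apply: cw].
  by apply: cvgM; [apply: cvgB; apply: cg | apply: cw].
- rewrite /E (_ : (fun q => g q (lo q)) = fun=> g p1 (rho p1)); last by apply/funext.
  by rewrite divAgrad_cst subr0 pmulr_lle0 ?invr_gt0 // subr_le0.
- rewrite /E (_ : (fun q => g q (hi q)) = fun=> g p2 (rho p2)); last by apply/funext.
  by rewrite divAgrad_cst subr0 divr_ge0 ?subr_ge0 // ltW.
exists v; split => p; first exact: lt_le_trans (lov p).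
by apply/eqP; rewrite -subr_eq0; apply/eqP; exact: Ev.
Qed.

Lemma diffusion_exists_unique : exists! v, diffusion_eq v.
Proof.
have [v hv] := diffusion_exists; exists v; split => // v'; exact: diffusion_unique.
Qed.

End nonlinear_diffusion.
End grid.

(** * Convexity of the entropy and of the reaction energy *)

Section entropy.
Variable R : realType.
Implicit Types x y a : R.

(** This is [ln (1 + z) <= z] at [z = x / y - 1]; the tangent inequality for [Fsp] is a
    rearrangement of it. *)
Lemma ln_le_lin x y : 0 < x -> 0 < y -> y * (ln x - ln y) <= x - y.
Proof.
move=> x0 y0; rewrite -ln_div // mulrC -ler_pdivlMr //.
have -> : x / y = 1 + (x / y - 1) by ring.
have -> : (x - y) / y = x / y - 1 by field; rewrite gt_eqF.
by apply: le_ln1Dx; rewrite ltrBrDr addNr divr_gt0.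
Qed.

Lemma Fsp_tangent a x y : 0 < x -> 0 < y ->
  Fsp a x + (ln x + a) * (y - x) <= Fsp a y.
Proof. by move=> x0 y0; have := ln_le_lin x0 y0; rewrite /Fsp; nra. Qed.

Lemma is_derive_Fsp a x : 0 < x -> is_derive x 1 (Fsp a) (ln x + a).
Proof.
move=> x0; have dln := is_derive1_ln x0.
have -> : Fsp a = (id * (@ln R - cst 1) + cst a * id)%R by [].
apply: is_derive_eq.
rewrite /GRing.scale /= -[X in _ + X * 1 + _]/(ln x - 1) subr0 mulfV ?gt_eqF //; ring.
Qed.

End entropy.

Section freac.
Variables (R : realType) (N : nat) (sigma U c0 : 'I_N -> R).
Definition cR_pos (x : R) : Prop := forall i, 0 < cR sigma c0 x i.

Lemma FreacE x : Freac sigma U c0 x = \sum_i Fsp (U i) (cR sigma c0 x i).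
Proof. by apply: eq_bigr => i _; rewrite /Fsp; ring. Qed.

Lemma Freac_tangent x y : cR_pos x -> cR_pos y ->
  Freac sigma U c0 x + (\sum_i sigma i * mu sigma U c0 x i) * (y - x)
    <= Freac sigma U c0 y.
Proof.
move=> hx hy; rewrite !FreacE mulr_suml -big_split /=; apply: ler_sum => i _.
apply: le_trans (Fsp_tangent (U i) (hx i) (hy i)); rewrite lerD2l /mu.
by rewrite le_eqVlt; apply/orP; left; apply/eqP; rewrite /cR; ring.
Qed.

Lemma is_derive_Freac x : cR_pos x ->
  is_derive x 1 (Freac sigma U c0) (\sum_i sigma i * mu sigma U c0 x i).
Proof.
move=> hx.
have -> : Freac sigma U c0 = \sum_(i < N) (Fsp (U i) \o (fun y => cR sigma c0 y i)).
  by apply/funext => y; rewrite FreacE fct_sumE.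
apply: is_derive_sum => i.
rewrite mulrC; apply: is_derive1_comp; first exact: is_derive_Fsp.
have -> : (fun y => cR sigma c0 y i) = (cst (c0 i) + cst (sigma i) * id)%R by [].
by apply: is_derive_eq; rewrite /GRing.scale /= !mulr0 add0r addr0 mulr1.
Qed.

End freac.

(** * Monotone logarithmic equations *)

Section log_root.
Variable R : realType.

Lemma root_between (f : R -> R) (a b : R) : a <= b ->
  (forall x, a <= x <= b -> {for x, continuous f}) -> f a <= 0 <= f b ->
  exists2 x, a <= x <= b & f x = 0.
Proof.
move=> ab fc /andP[fa fb].
have [||x xab fx] := @IVT _ f a b 0 ab.
- apply: continuous_in_subspaceT => x; rewrite inE /= in_itv /=; exact: fc.
- by rewrite (min_l (le_trans fa fb)) (max_r (le_trans fa fb)) fa.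
by exists x => //; move: xab; rewrite in_itv.
Qed.

(** The derivative [s ^+ 2 / (c + s * x)] is positive for either sign of [s]. *)
Lemma scaled_ln_lt (c s x y : R) : s != 0 -> 0 < c + s * x -> 0 < c + s * y -> x < y ->
  s * ln (c + s * x) < s * ln (c + s * y).
Proof.
move=> s0 hx hy xy; case: (ltgtP s 0) s0 => // ss _.
  by rewrite ltr_nM2l // ltr_ln ?posrE // ltrD2l ltr_nM2l.
by rewrite ltr_pM2l // ltr_ln ?posrE // ltrD2l ltr_pM2l.
Qed.

Definition log_dom (I : finType) (c s : I -> R) (x : R) := forall j, 0 < c j + s j * x.
(** The weight [w] is separate from [s] so that the species can carry a factor 1 or [tau] while the
    fictitious species keeps weight 1; [psi] collects the remaining nondecreasing terms. *)
Definition log_fun (I : finType) (c s w : I -> R) (psi : R -> R) (x : R) :=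
  \sum_j w j * (s j * ln (c j + s j * x)) + psi x.

Lemma log_dom0 (I : finType) (c s : I -> R) : (forall j, 0 < c j) -> log_dom c s 0.
Proof. by move=> c0 j; rewrite mulr0 addr0. Qed.

Lemma log_dom_between (I : finType) (c s : I -> R) a b x :
  log_dom c s a -> log_dom c s b -> a <= x <= b -> log_dom c s x.
Proof.
move=> da db /andP[ax xb] j; have := da j; have := db j.
by case: (leP 0 (s j)) => ?; nra.
Qed.

Section increasing.
Variables (I : finType) (c s w : I -> R) (psi : R -> R).
Hypothesis c_gt0 : forall j, 0 < c j.
Hypothesis s_neq0 : forall j, s j != 0.
Hypothesis w_gt0 : forall j, 0 < w j.
Hypothesis psi_le : forall x y, log_dom c s x -> log_dom c s y -> x <= y -> psi x <= psi y.

Lemma log_fun_lt x y (j0 : I) : log_dom c s x -> log_dom c s y -> x < y ->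
  log_fun c s w psi x < log_fun c s w psi y.
Proof.
move=> dx dy xy; apply: ltr_leD; last exact/psi_le/ltW.
have H j : w j * (s j * ln (c j + s j * x)) < w j * (s j * ln (c j + s j * y)).
  by rewrite ltr_pM2l //; apply: scaled_ln_lt.
rewrite (bigD1 j0) //= [ltRHS](bigD1 j0) //=; apply: ltr_leD => //.
by apply: ler_sum => j _; apply: ltW.
Qed.

(* Approach the endpoint at which the first decreasing component j0 vanishes. *)
Lemma log_fun_ge0 (j1 : I) : s j1 < 0 ->
  exists y, [/\ log_dom c s y, 0 <= y & 0 <= log_fun c s w psi y].
Proof.
move=> sj1.
have [j0 sj0 hmin] := arg_minP (P := [pred j | s j < 0]) (fun j => c j / - s j) sj1.
rewrite inE in sj0.
pose rad := c j0 / - s j0.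
have rad0 : 0 < rad by rewrite divr_gt0 // oppr_gt0.
(* [K] makes the gain of the [j0] term between 0 and [y], namely [w j0 * s j0 * ln e], equal to the
   absolute value of the function at 0. *)
pose K := `|log_fun c s w psi 0| / (w j0 * - s j0).
have wsj0 : 0 < w j0 * - s j0 by rewrite mulr_gt0 // oppr_gt0.
have K0 : 0 <= K by rewrite divr_ge0 // ltW.
pose e := expR (- K).
have e0 : 0 < e by exact: expR_gt0.
have e1 : e <= 1 by rewrite -expR0 ler_expR oppr_le0.
(* At this point component [j0] retains the fraction [e] of [c j0]. *)
pose y := rad * (1 - e).
have y0 : 0 <= y by rewrite mulr_ge0 ?subr_ge0 // ltW.
have dy : log_dom c s y.
  move=> j; case: (leP 0 (s j)) => sj; first by have := c_gt0 j; nra.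
  have : rad <= c j / - s j by apply: hmin.
  rewrite ler_pdivlMr ?oppr_gt0 // => h.
  have := mulr_gt0 (c_gt0 j) e0.
  have : 0 <= (c j - rad * - s j) * (1 - e) by rewrite mulr_ge0 ?subr_ge0.
  by rewrite /y; nra.
exists y; split => //.
have d0 := @log_dom0 I c s c_gt0.
apply: (@le_trans _ _ (log_fun c s w psi 0 + w j0 * s j0 * ln e)).
  rewrite /e expRK.
  have -> : w j0 * s j0 * - K = `|log_fun c s w psi 0|.
    have wn : w j0 != 0 by rewrite gt_eqF.
    by rewrite /K; field; rewrite ?wn ?s_neq0.
  by rewrite -lerBlDl sub0r -normrN ler_norm.
rewrite /log_fun addrAC; apply: lerD; last exact: psi_le.
rewrite (bigD1 j0) //= [leRHS](bigD1 j0) //= addrAC; apply: lerD.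
  have -> : c j0 + s j0 * y = c j0 * e by rewrite /y /rad; field; rewrite s_neq0.
  by rewrite mulr0 addr0 lnM ?posrE //; lra.
apply: ler_sum => j _; rewrite ler_pM2l //.
have [<-//|y0'] := eqVneq 0 y.
by apply/ltW/scaled_ln_lt => //; rewrite lt_neqAle y0'.
Qed.

End increasing.

Lemma log_fun_root (I : finType) (c s w : I -> R) (psi : R -> R) (j1 j2 : I) :
  (forall j, 0 < c j) -> (forall j, s j != 0) -> (forall j, 0 < w j) ->
  s j1 < 0 -> 0 < s j2 ->
  (forall x y, log_dom c s x -> log_dom c s y -> x <= y -> psi x <= psi y) ->
  (forall x, log_dom c s x -> {for x, continuous psi}) ->
  exists! x, log_dom c s x /\ log_fun c s w psi x = 0.
Proof.
move=> c0 s0 w0 sj1 sj2 psi_le psi_cont.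
have [b [db b0 fb]] := log_fun_ge0 c0 s0 w0 psi_le sj1.
have domN x : log_dom c (fun j => - s j) x -> log_dom c s (- x).
  by move=> dx j; have := dx j; rewrite mulrN mulNr.
(* Reflecting [x] and [s] makes the increasing component [j2] a decreasing one, and yields a point
   where the original function is nonpositive. *)
have [|||a [/domN da a0 fa]] :=
    @log_fun_ge0 I c (fun j => - s j) w (fun x => - psi (- x)) c0 _ w0 _ j2.
- by move=> j; rewrite oppr_eq0.
- by move=> x y /domN dx /domN dy xy; rewrite lerN2 psi_le // lerN2.
- by rewrite oppr_lt0.
have {}fa : log_fun c s w psi (- a) <= 0.
  rewrite -oppr_ge0; congr (0 <= _) : fa.
  rewrite /log_fun opprD -sumrN; congr (_ + _); apply: eq_bigr => j _.
  by rewrite mulNr mulrN mulNr mulrN.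
have ab : - a <= b by rewrite (le_trans _ b0) // oppr_le0.
have [||x xab fx] := @root_between (log_fun c s w psi) (- a) b ab.
- move=> x xab; have dx := log_dom_between da db xab.
  apply: cvgD; last exact: psi_cont.
  apply: cvg_big => [|j _]; first exact: add_continuous.
  apply: cvgM; first exact: cvg_cst.
  apply: cvgM; first exact: cvg_cst.
  apply: continuous_comp; last exact: continuous_ln.
  apply: cvgD; first exact: cvg_cst.
  by apply: cvgM; [exact: cvg_cst | exact: cvg_id].
- by rewrite fa fb.
have dx := log_dom_between da db xab.
exists x; split => // y [dy fy]; apply/eqP; case: ltgtP => // xy.
- by have := @log_fun_lt _ _ _ _ _ s0 w0 psi_le _ _ j1 dx dy xy; rewrite fx fy ltxx.
- by have := @log_fun_lt _ _ _ _ _ s0 w0 psi_le _ _ j1 dy dx xy; rewrite fx fy ltxx.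
Qed.

End log_root.

(** * The reaction stage at one grid point *)

Lemma eq_exists_unique (T : Type) (A B : T -> Prop) :
  (forall x, A x <-> B x) -> (exists! x, A x) -> exists! x, B x.
Proof. by move=> AB; have -> : A = B by apply/funext => x; apply/propext. Qed.

Section reaction.
Variables (R : realType) (N r : nat).
Hypothesis hr : (1 <= r < N)%N.
Variable sigma : 'I_N -> R.
Hypothesis sigma_lt0 : forall i : 'I_N, (i < r)%N -> sigma i < 0.
Hypothesis sigma_gt0 : forall i : 'I_N, (r <= i)%N -> 0 < sigma i.
Variables (U : 'I_N -> R) (km : R).
Hypothesis km_gt0 : 0 < km.
Implicit Types (c : 'I_N -> R) (x e tau : R).

Lemma sigma_neq0 i : sigma i != 0.
Proof.
by case: (leqP r i) => ir; [rewrite gt_eqF ?sigma_gt0 | rewrite lt_eqF ?sigma_lt0].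
Qed.

Lemma eta_gt0 c : (forall i, 0 < c i) -> 0 < Defs.eta r sigma km c.
Proof. by move=> c0; rewrite mulr_gt0 // prodr_gt0 // => i _; apply: powR_gt0. Qed.

(* The logarithm of x / e + 1 acts as that of one more species, with concentration e + x. *)
Lemma react_root c e (wt : R) (psi : R -> R) :
  (forall i, 0 < c i) -> 0 < e -> 0 < wt ->
  (forall x y, cR_pos sigma c x -> cR_pos sigma c y -> x <= y -> psi x <= psi y) ->
  (forall x, cR_pos sigma c x -> {for x, continuous psi}) ->
  exists! x, cR_pos sigma c x /\ 0 < x + e /\
    ln (x / e + 1) + wt * (\sum_i sigma i * ln (cR sigma c x i)) + psi x = 0.
Proof.
move=> c0 e0 wt0 psi_le psi_cont.
pose C (j : 'I_N.+1) := oapp c e (unlift ord0 j).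
pose S (j : 'I_N.+1) := oapp sigma 1 (unlift ord0 j).
pose W (j : 'I_N.+1) := oapp (fun=> wt) 1 (unlift ord0 j).
have dom x : log_dom C S x <-> cR_pos sigma c x /\ 0 < x + e.
  split=> [d|[d1 d2] j].
    split=> [i|]; first by have := d (lift ord0 i); rewrite /C /S liftK.
    by have := d ord0; rewrite /C /S unlift_none /= mul1r addrC.
  rewrite /C /S; case: unliftP => [i _|_] /=; first exact: d1.
  by rewrite mul1r addrC.
have [r0 rN] := andP hr.
(* A reactant exists because [1 <= r] and supplies the negative slope; the fictitious species
   [ord0], with slope 1, supplies the positive one. *)
pose j1 := lift ord0 (Ordinal (ltn_trans r0 rN)).
have main : exists! x, log_dom C S x /\ log_fun C S W (fun x => psi x - ln e) x = 0.
  apply: (@log_fun_root R _ C S W _ j1 ord0).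
  - by move=> j; rewrite /C; case: unliftP => [i _|_] /=.
  - by move=> j; rewrite /S; case: unliftP => [i _|_] /=; rewrite ?sigma_neq0 ?oner_neq0 //.
  - by move=> j; rewrite /W; case: unliftP => [i _|_] /=.
  - by rewrite /S liftK /= sigma_lt0.
  - by rewrite /S unlift_none.
  - by move=> x y /dom[dx _] /dom[dy _] xy; rewrite lerD2r psi_le.
  - move=> x /dom[dx _]; apply: cvgB; [exact: psi_cont | exact: cvg_cst].
apply: eq_exists_unique main => x; rewrite dom -and_assoc.
suff E : cR_pos sigma c x /\ 0 < x + e -> log_fun C S W (fun x => psi x - ln e) x =
    ln (x / e + 1) + wt * (\sum_i sigma i * ln (cR sigma c x i)) + psi x.
  by split=> -[dx fx]; split => //; move: fx; rewrite E.
move=> [_ xe].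
have -> : x / e + 1 = (x + e) / e by field; rewrite gt_eqF.
rewrite ln_div ?posrE // /log_fun big_ord_recl mulr_sumr.
under eq_bigr do rewrite /W /C /S liftK /=.
rewrite /C /S /W unlift_none /= !mul1r (addrC e x) /cR; ring.
Qed.

(** Each [mu] is a logarithm plus a constant, so this is [react_root] with weight 1 and constant
    [psi]. *)
Lemma react_pred_exists_unique c tau : 0 < tau -> (forall i, 0 < c i) ->
  exists! Rh, react_pred r sigma U km tau c Rh.
Proof.
move=> tau0 c0.
have e0 : 0 < Defs.eta r sigma km c * tau by rewrite mulr_gt0 ?eta_gt0.
have := @react_root c _ 1 (fun=> \sum_i sigma i * U i) c0 e0 ltr01.
move=> /(_ (fun _ _ _ _ _ => lexx _)) /(_ (fun _ _ => cvg_cst _)).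
apply: eq_exists_unique => x; rewrite /react_pred.
have -> : \sum_i sigma i * mu sigma U c x i =
    1 * (\sum_i sigma i * ln (cR sigma c x i)) + \sum_i sigma i * U i.
  by rewrite mul1r -big_split; apply: eq_bigr => i _; rewrite /mu /=; ring.
by split=> -[? [? fx]]; split => //; split => //; lra.
Qed.

Lemma cR0 c : cR sigma c 0 = c.
Proof. by apply/funext => i; rewrite /cR mulr0 addr0. Qed.

(** The state at [Rh / 2] is the midpoint of two positive states. *)
Lemma react_pred_eta c tau Rh : (forall i, 0 < c i) -> react_pred r sigma U km tau c Rh ->
  0 < Defs.eta r sigma km (cR sigma c (Rh / 2)).
Proof.
move=> c0 [hR _]; apply: eta_gt0 => i; have := hR i; have := c0 i; rewrite /cR; lra.
Qed.

(** This is [react_root] with weight [tau]; the difference quotient goes into [psi], nondecreasing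
    because the energy is convex along the reaction line. *)
Lemma react_corr_exists_unique c tau Rh : 0 < tau -> (forall i, 0 < c i) ->
  react_pred r sigma U km tau c Rh -> exists! x, react_corr r sigma U km tau c Rh x.
Proof.
move=> tau0 c0 hRh; have eta0 := react_pred_eta c0 hRh.
have e0 := mulr_gt0 eta0 tau0.
have pos0 : cR_pos sigma c 0 by rewrite /cR_pos cR0.
have tang := @Freac_tangent R N sigma U c; have der := @is_derive_Freac R N sigma U c.
pose K := tau * \sum_i sigma i * (U i - mu sigma U c 0 i).
have [x y dx dy xy|x dx|x0 Hx0] :=
    @react_root c _ tau (fun x => phi (Freac sigma U c) x 0 + K) c0 e0 tau0.
- by rewrite lerD2r; apply: (phi_le tang der).
- by apply: cvgD; [exact: (phi_continuous der) | exact: cvg_cst].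
apply: eq_exists_unique (ex_intro _ x0 Hx0) => x; rewrite /react_corr.
have -> : tau * (\sum_i sigma i * (mu sigma U c x i - mu sigma U c 0 i)) =
    tau * (\sum_i sigma i * ln (cR sigma c x i)) + K.
  by rewrite /K -mulrDr -big_split; congr (_ * _); apply: eq_bigr => i _; rewrite /mu /=; ring.
by split=> -[? [? fx]]; split => //; split => //; lra.
Qed.

Lemma sgn_ln_ge0 x e : 0 < e -> 0 < x + e -> 0 <= x * ln (x / e + 1).
Proof.
move=> e0 xe; have p : 0 < x / e + 1.
  by have -> : x / e + 1 = (x + e) / e by [field; rewrite gt_eqF]; rewrite divr_gt0.
case: (lerP 0 x) => hx.
  by rewrite mulr_ge0 // ln_ge0 // lerDr divr_ge0 // ltW.
rewrite mulr_le0 ?ltW // ln_lt0 // p /= gtrDr pmulr_llt0 ?invr_gt0 //.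
Qed.

Lemma Freac_le c tau Rh x : 0 < tau -> (forall i, 0 < c i) ->
  react_pred r sigma U km tau c Rh -> react_corr r sigma U km tau c Rh x ->
  Freac sigma U c x <= Freac sigma U c 0.
Proof.
move=> tau0 c0 hRh [dx [xe Ex]]; have eta0 := react_pred_eta c0 hRh.
have e0 := mulr_gt0 eta0 tau0.
rewrite -subr_le0 -phiM subr0.
have h1 := sgn_ln_ge0 e0 xe.
(* Each [sigma i * ln (c i + sigma i * x)] increases with [x], so its increment from 0 has the sign
   of [x]. *)
have h2 : 0 <= x * \sum_i sigma i * (mu sigma U c x i - mu sigma U c 0 i).
  rewrite mulr_sumr; apply: sumr_ge0 => i _.
  rewrite /mu cR0 opprD addrACA subrr addr0.
  case: (ltgtP x 0) => [hx|hx|->]; last by rewrite mul0r.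
    have := @scaled_ln_lt R (c i) (sigma i) x 0 (sigma_neq0 i) (dx i).
    rewrite mulr0 addr0 => /(_ (c0 i) hx); rewrite /cR; nra.
  have := @scaled_ln_lt R (c i) (sigma i) 0 x (sigma_neq0 i).
  rewrite mulr0 addr0 => /(_ (c0 i) (dx i) hx); rewrite /cR; nra.
have := mulr_ge0 (ltW tau0) h2; nra.
Qed.

End reaction.

(** * The predictor-corrector diffusion stage *)

Section variable_diffusion.
Variables (R : realType) (N0 : nat) (D : R -> R) (a tau : R) (rho : pt N0 -> R).
Hypothesis N0_gt0 : (0 < N0)%N.
Hypothesis D_gt0 : forall x, 0 < x -> 0 < D x.
Hypothesis tau_gt0 : 0 < tau.
Hypothesis rho_gt0 : forall p, 0 < rho p.

Lemma diff_pred_exists_unique : exists! rhoh, diff_pred D tau rho rhoh.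
Proof.
apply: (@diffusion_exists_unique R N0 N0_gt0 (fun q => D (rho q)) (fun _ x => x)) => //.
- by move=> p; rewrite ltW ?D_gt0.
- by move=> _ x _; exact: cvg_id.
- by move=> _ q; exists (rho q).
Qed.

Let g (q : pt N0) (x : R) : R := Q a x (rho q) + tau * (ln x - ln (rho q)).

Let Q_le q x y : 0 < q -> 0 < x -> x <= y -> Q a x q <= Q a y q.
Proof.
move=> q0 x0 xy.
by apply: (phi_le (@Fsp_tangent R a) (@is_derive_Fsp R a)) => //; apply: lt_le_trans xy.
Qed.

Let g_lt q x y : 0 < x -> x < y -> g q x < g q y.
Proof.
move=> x0 xy; apply: ler_ltD; first by rewrite Q_le // ltW.
by rewrite ltr_pM2l // ltrD2r ltr_ln ?posrE // (lt_trans x0).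
Qed.

Let g_cont q x : 0 < x -> {for x, continuous (g q)}.
Proof.
move=> x0; apply: cvgD; first exact: (phi_continuous (@is_derive_Fsp R a)).
apply: cvgM; first exact: cvg_cst.
by apply: cvgB; [exact: continuous_ln | exact: cvg_cst].
Qed.

(** Scaling the argument by [expR K] or [expR (- K)] moves the term [tau * ln] by [tau * K], and the
    monotone [Q] only helps. With [tau * K] the distance to the target value, the two scaled points
    bracket it. *)
Let g_range p q : exists2 t, 0 < t & g p t = g q (rho q).
Proof.
set m := g q (rho q); pose K := `|g p (rho p) - m| / tau.
have K0 : 0 <= K by rewrite divr_ge0 // ltW.
have KE : tau * K = `|g p (rho p) - m| by rewrite /K; field; rewrite gt_eqF.
pose t1 := rho p * expR (- K); pose t2 := rho p * expR K.
have t10 : 0 < t1 by rewrite mulr_gt0 // expR_gt0.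
have lt1 : t1 <= rho p by rewrite ger_pMr // -expR0 ler_expR oppr_le0.
have lt2 : rho p <= t2 by rewrite ler_pMr // -expR0 ler_expR.
have gE : g p (rho p) = Q a (rho p) (rho p) by rewrite /g (subrr (ln (rho p))) mulr0 addr0.
have [||x /andP[t1x _] gx] := @root_between R (fun x => g p x - m) t1 t2 (le_trans lt1 lt2).
- move=> x /andP[t1x _]; apply: cvgB; last exact: cvg_cst.
  by apply: g_cont; apply: lt_le_trans t1x.
- have := Q_le (rho_gt0 p) t10 lt1; have := Q_le (rho_gt0 p) (rho_gt0 p) lt2.
  have := ler_norm (g p (rho p) - m); have := ler_norm (- (g p (rho p) - m)).
  rewrite normrN -KE gE /g /t1 /t2 !lnM ?posrE ?expR_gt0 // !expRK => h1 h2 h3 h4.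
  by apply/andP; split; lra.
exists x; first exact: lt_le_trans t1x.
by apply/eqP; rewrite -subr_eq0 gx.
Qed.

Section corrector.
Variable rhoh : pt N0 -> R.
Hypothesis pred_rhoh : diff_pred D tau rho rhoh.
Let half (q : pt N0) := (rho q + rhoh q) / 2.

Let weight_ge0 q : 0 <= D (half q) * half q.
Proof.
have h0 : 0 < half q by rewrite divr_gt0 // addr_gt0 // pred_rhoh.1.
by rewrite mulr_ge0 // ltW // D_gt0.
Qed.

Lemma diff_corr_exists_unique : exists! rho', diff_corr D a tau rho rhoh rho'.
Proof.
exact: (@diffusion_exists_unique R N0 N0_gt0 (fun q => D (half q) * half q) g).
Qed.

(** By [phiM] the energy change is [Q] times the density increment. Replacing [Q] by the full
    potential adds [tau] times a product of two increments of equal sign, after which the scheme and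
    summation by parts apply. *)
Lemma diff_corr_energy rho' : diff_corr D a tau rho rhoh rho' ->
  \sum_p Fsp a (rho' p) <= \sum_p Fsp a (rho p).
Proof.
move=> [rho'0 E]; pose m q := g q (rho' q).
rewrite -subr_le0 -sumrB.
apply: (@le_trans _ _ (tau * \sum_p m p * divAgrad (fun q => D (half q) * half q) m p)).
  rewrite mulr_sumr; apply: ler_sum => p _.
  rewrite -phiM -[phi _ _ _]/(Q a (rho' p) (rho p)) -E mulrCA.
  rewrite (_ : tau * ((rho' p - rho p) / tau) = rho' p - rho p); last first.
    by field; rewrite gt_eqF.
  rewrite /m /g mulrDl lerDl -mulrA mulr_ge0 ?(ltW tau_gt0) //.
  case: (ltgtP (rho' p) (rho p)) => h; last by rewrite h !subrr mulr0.
    by rewrite mulr_le0 // subr_le0 ?ler_ln ?posrE // ltW.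
  by rewrite mulr_ge0 // subr_ge0 ?ler_ln ?posrE // ltW.
by rewrite pmulr_rle0 // sum_divAgrad_le0.
Qed.

End corrector.
End variable_diffusion.

(** * Euler's limit for exponential series *)

Section exponential.
Variables (R : realType).

(** Passing from [k] to [k.+1] multiplies the ratio by [1 - k / n], and these losses add up to at
    most [k ^ 2 / n]. *)
Lemma ffact_ratio_bounds (n k : nat) : (0 < n)%N -> (k <= n)%N ->
  1 - (k%:R : R) ^+ 2 / n%:R <= (n ^_ k)%:R / n%:R ^+ k <= (1 : R).
Proof.
move=> n0; have nR : 0 < n%:R :> R by rewrite ltr0n.
elim: k => [_|k IH kn]; first by rewrite ffactn0 expr0 divr1 expr2 !mul0r subr0 lexx.
have /andP[] := IH (ltnW kn).
rewrite ffactnSr natrM natrB ?(ltnW kn) // (exprSr (n%:R : R)).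
set q := (n ^_ k)%:R / n%:R ^+ k => lq q1.
have -> : (n ^_ k)%:R * (n%:R - k%:R) / (n%:R ^+ k * n%:R) = q * (1 - k%:R / n%:R).
  by rewrite /q; field; rewrite gt_eqF //= expf_neq0 // gt_eqF.
have q0 : 0 <= q by rewrite divr_ge0 ?exprn_ge0.
have z0 : 0 <= k%:R / n%:R :> R by rewrite divr_ge0.
apply/andP; split; last by nra.
have -> : k.+1%:R ^+ 2 / n%:R = k%:R ^+ 2 / n%:R + 2 * (k%:R / n%:R) + n%:R^-1 :> R.
  by rewrite -natr1; field; rewrite gt_eqF.
have ni : 0 < n%:R^-1 :> R by rewrite invr_gt0.
nra.
Qed.

Lemma sqr_le_exp4 (k : nat) : k%:R ^+ 2 <= 4 ^+ k :> R.
Proof.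
have -> : 4 = 2 ^+ 2 :> R by rewrite -natrX.
rewrite -exprM mulnC exprM lerXn2r ?nnegrE ?exprn_ge0 //.
by rewrite -natrX ler_nat ltnW // ltn_expl.
Qed.

Variables (f : nat -> R) (M K a : R).
Hypothesis f_bound : forall k, `|f k| <= M * K ^+ k.
Hypothesis K_ge0 : 0 <= K.
Hypothesis a_ge0 : 0 <= a.

Let e k : R := a ^+ k / k`!%:R * f k.

Let M_ge0 : 0 <= M.
Proof. by have := f_bound 0; rewrite expr0 mulr1; apply: le_trans. Qed.

Lemma is_cvg_exp_series : cvgn (series e).
Proof.
apply: normed_cvg.
apply: (@series_le_cvg _ _ (fun k => M *: exp_coeff (a * K) k)) => [k|k|k|].
- exact: normr_ge0.
- by rewrite /GRing.scale /= mulr_ge0 // exp_coeff_ge0 // mulr_ge0.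
- rewrite /= /e normrM /exp_coeff /GRing.scale /= exprMn ger0_norm; last first.
    by rewrite divr_ge0 ?exprn_ge0.
  have -> : M * (a ^+ k * K ^+ k / k`!%:R) = a ^+ k / k`!%:R * (M * K ^+ k) by ring.
  by rewrite ler_wpM2l // divr_ge0 ?exprn_ge0.
- exact/is_cvg_seriesZ/is_cvg_series_exp_coeff.
Qed.

Lemma exp_partial_sum_le (x : R) n : 0 <= x -> \sum_(k < n) x ^+ k / k`!%:R <= expR x.
Proof.
move=> x0; have -> : \sum_(k < n) x ^+ k / k`!%:R = series (exp_coeff x) n.
  by rewrite /series /= big_mkord.
apply: nondecreasing_cvgn_le; last exact: is_cvg_series_exp_coeff.
by apply: nondecreasing_series => k _ _; apply: exp_coeff_ge0.
Qed.

(* Tannery's theorem with an explicit rate: the k-th coefficients differ by a factor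
   1 - O(k^2/n), and k^2 <= 4^k. *)
Lemma euler_error n : (0 < n)%N ->
  `|\sum_(k < n.+1) 'C(n, k)%:R * (a / n%:R) ^+ k * f k - series e n.+1|
    <= M * expR (4 * (a * K)) / n%:R.
Proof.
move=> n0; have nR : 0 < n%:R :> R by rewrite ltr0n.
rewrite /series /= big_mkord -sumrB (le_trans (ler_norm_sum _ _ _)) //.
apply: (@le_trans _ _ (\sum_(k < n.+1) M / n%:R * ((4 * (a * K)) ^+ k / k`!%:R))); last first.
  rewrite -mulr_sumr [leRHS]mulrAC ler_wpM2l ?divr_ge0 //.
  by rewrite exp_partial_sum_le // !mulr_ge0.
apply: ler_sum => -[k /= kn] _; rewrite ltnS in kn.
have := ffact_ratio_bounds n0 kn.
have fk0 : 0 < k`!%:R :> R by rewrite ltr0n fact_gt0.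
(* A binomial coefficient is a falling factorial divided by [k!]. *)
have -> : 'C(n, k)%:R * (a / n%:R) ^+ k * f k - e k =
  e k * ((n ^_ k)%:R / n%:R ^+ k - 1).
  have nn : n%:R != 0 :> R by rewrite gt_eqF.
  have kk : k`!%:R != 0 :> R by rewrite gt_eqF.
  by rewrite -bin_ffact natrM /e expr_div_n; field; rewrite ?kk ?nn ?expf_neq0.
set q := (n ^_ k)%:R / _ => /andP[lq q1].
rewrite normrM.
have he : `|e k| <= M * ((a * K) ^+ k / k`!%:R).
  rewrite /e normrM exprMn ger0_norm; last by rewrite divr_ge0 ?exprn_ge0.
  have -> : M * (a ^+ k * K ^+ k / k`!%:R) = a ^+ k / k`!%:R * (M * K ^+ k) by ring.
  by rewrite ler_wpM2l // divr_ge0 ?exprn_ge0.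
have hq : `|q - 1| <= 4 ^+ k / n%:R.
  rewrite ler0_norm ?subr_le0 // opprB lerBlDr -lerBlDl (le_trans _ lq) // lerD2l lerN2.
  by rewrite ler_pM2r ?invr_gt0 // sqr_le_exp4.
apply: (le_trans (ler_pM _ _ he hq)); rewrite ?normr_ge0 // [(4 * _) ^+ _]exprMn.
by rewrite le_eqVlt; apply/orP; left; apply/eqP; ring.
Qed.

Lemma cvg_euler :
  ((\sum_(k < n.+1) 'C(n, k)%:R * (a / n%:R) ^+ k * f k) @[n --> \oo] --> limn (series e))%classic.
Proof.
(* The binomial sum of order [n] has [n + 1] terms, hence the shifted partial sums. *)
have ce : (series e n.+1 @[n --> \oo] --> limn (series e))%classic.
  by rewrite (cvg_shiftS (series e)); exact: is_cvg_exp_series.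
pose C := M * expR (4 * (a * K)).
have ch : ((C / n%:R) @[n --> \oo] --> (0 : R))%classic.
  rewrite -(mulr0 C); apply: cvgM; first exact: cvg_cst.
  by rewrite -(cvg_shiftS (fun n => n%:R^-1 : R)); exact: cvg_harmonic.
pose T n := \sum_(k < n.+1) 'C(n, k)%:R * (a / n%:R) ^+ k * f k.
have cd : ((T n - series e n.+1) @[n --> \oo] --> (0 : R))%classic.
  apply/cvgr0Pnorm_le => eps eps0.
  near=> n; have n0 : (0 < n)%N by near: n; exact: nbhs_infty_gt.
  apply: le_trans (euler_error n0) _; apply: ltW.
  by near: n; exact: (cvgr_lt _ ch).
have -> : (fun n => \sum_(k < n.+1) 'C(n, k)%:R * (a / n%:R) ^+ k * f k) =
    (fun n => series e n.+1 + (T n - series e n.+1)).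
  by apply/funext => n; rewrite addrC subrK.
by rewrite -(addr0 (limn _)); apply: cvgD.
Unshelve. all: by end_near.
Qed.

End exponential.

(** * The discrete heat semigroup *)

Section heat_semigroup.
Variables (R : realType) (N0 : nat).
Hypothesis N0_gt0 : (0 < N0)%N.
Implicit Types (u v : pt N0 -> R) (p : pt N0) (s a m : R).
Let h2 := hstep R N0 ^+ 2.

Let h2_gt0 : 0 < h2.
Proof. by rewrite exprn_gt0 // hstep_gt0. Qed.

(** One explicit Euler step for the discrete heat equation. *)
Definition euler s u : pt N0 -> R := fun p => u p + s * lap u p.

Lemma lap_lin s u v p : lap (fun q => u q + s * v q) p = lap u p + s * lap v p.
Proof. by rewrite /lap mulr_sumr -big_split; apply: eq_bigr => d _ /=; ring. Qed.

Lemma lap_cst s p : @lap R N0 (fun=> s) p = 0.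
Proof. by rewrite /lap big1 // => d _; rewrite (_ : _ + _ - _ = 0) ?mul0r //; ring. Qed.

Lemma iter_lap_lin s u v k :
  iter k (@lap R N0) (fun q => u q + s * v q) =
  fun q => iter k (@lap R N0) u q + s * iter k (@lap R N0) v q.
Proof.
by elim: k => //= k ->; apply/funext => p; rewrite lap_lin.
Qed.

(** Each of the three second differences is at most [4 * M] in absolute value. *)
Lemma lap_bound u (M : R) p : (forall q, `|u q| <= M) -> `|lap u p| <= M * (12 / h2).
Proof.
move=> uM; have M0 : 0 <= M := le_trans (normr_ge0 _) (uM p).
rewrite /lap (le_trans (ler_norm_sum _ _ _)) //.
have -> : M * (12 / h2) = \sum_(d < 3) (4 * M) / h2.
  by rewrite sumr_const card_ord -mulr_natr; ring.
apply: ler_sum => d _.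
rewrite normrM (ger0_norm (_ : 0 <= h2^-1)) ?invr_ge0 ?(ltW h2_gt0) // ler_pM2r ?invr_gt0 //.
have := uM (fwd d p); have := uM (bwd d p); have := uM p.
by rewrite !ler_norml => /andP[? ?] /andP[? ?] /andP[? ?]; apply/andP; split; lra.
Qed.

Lemma iter_lap_bound u (M : R) k p : (forall q, `|u q| <= M) ->
  `|iter k (@lap R N0) u p| <= M * (12 / h2) ^+ k.
Proof.
move=> uM; elim: k p => [|k IH] p; first by rewrite expr0 mulr1.
by rewrite exprSr (mulrA M); apply: (@lap_bound (iter k (@lap R N0) u)).
Qed.

(** The binomial theorem for powers of the identity plus [s] times the Laplacian, by Pascal's
    rule. *)
Lemma iter_eulerE s u n p : iter n (euler s) u p =
  \sum_(k < n.+1) 'C(n, k)%:R * s ^+ k * iter k (@lap R N0) u p.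
Proof.
elim: n u => [|n IH] u; first by rewrite big_ord1 bin0 expr0 !mul1r.
rewrite iterSr IH /euler [RHS]big_ord_recl bin0 expr0 !mul1r.
have -> : \sum_(i < n.+1) 'C(n.+1, lift ord0 i)%:R * s ^+ (lift ord0 i) *
    iter (lift ord0 i) (@lap R N0) u p
  = \sum_(i < n.+1) 'C(n, i.+1)%:R * s ^+ i.+1 * iter i.+1 (@lap R N0) u p
  + \sum_(i < n.+1) 'C(n, i)%:R * s ^+ i.+1 * iter i.+1 (@lap R N0) u p.
  by rewrite -big_split; apply: eq_bigr => i _; rewrite /= binS natrD; ring.
rewrite addrA.
have -> : iter (ord0 : 'I_n.+2) (@lap R N0) u p +
    \sum_(i < n.+1) 'C(n, i.+1)%:R * s ^+ i.+1 * iter i.+1 (@lap R N0) u p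
  = \sum_(i < n.+1) 'C(n, i)%:R * s ^+ i * iter i (@lap R N0) u p.
  pose G i := 'C(n, i)%:R * s ^+ i * iter i (@lap R N0) u p.
  (* The extra term vanishes because ['C(n, n.+1)] is 0. *)
  have <- : \sum_(i < n.+2) G i = \sum_(i < n.+1) G i.
    by rewrite big_ord_recr /= /G bin_small // !mul0r addr0.
  by rewrite [RHS]big_ord_recl /G /= bin0 expr0 !mul1r.
rewrite -big_split; apply: eq_bigr => i _ /=.
by rewrite (iter_lap_lin s u) exprSr -iterS iterSr; ring.
Qed.

Lemma cvg_iter_euler a u p : 0 <= a ->
  (iter n (euler (a / n%:R)) u p @[n --> \oo] --> expLap a u p)%classic.
Proof.
move=> a0.
have [q hq] := exists_max N0_gt0 (fun q => `|u q|).
have K0 : 0 <= 12 / h2 by rewrite divr_ge0 // ltW.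
under eq_cvg do rewrite iter_eulerE.
exact: (cvg_euler (fun k => iter_lap_bound k p hq) K0 a0).
Qed.

Section stable_step.
Variable s : R.
Hypothesis s_ge0 : 0 <= s.
Hypothesis s_stable : s * (6 / h2) <= 1.

(** Under [s_stable] the coefficient [1 - s * (6 / h2)] of the centre value is nonnegative, as are
    the coefficients [s / h2] of the neighbours. *)
Lemma euler_le u v p : (forall q, u q <= v q) -> euler s u p <= euler s v p.
Proof.
move=> uv; rewrite /euler.
have : - (v p - u p) * (6 / h2) <= lap v p - lap u p.
  rewrite (_ : - (v p - u p) * (6 / h2) = \sum_(d < 3) (- (2 * (v p - u p)) / h2)); last first.
    by rewrite sumr_const card_ord -mulr_natr; ring.
  rewrite /lap -sumrB; apply: ler_sum => d _.
  rewrite -mulrBl ler_pM2r ?invr_gt0 //.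
  by have := uv (fwd d p); have := uv (bwd d p); lra.
move=> /(ler_wpM2l s_ge0); have := uv p => uvp; have w0 : 0 <= v p - u p by rewrite subr_ge0.
have := ler_wpM2l w0 s_stable; nra.
Qed.

Lemma euler_affine u (b c : R) p : euler s (fun q => b + c * u q) p = b + c * euler s u p.
Proof. by rewrite /euler (lap_lin c (fun=> b)) lap_cst; ring. Qed.

Lemma euler_ge u m : (forall q, m <= u q) -> forall p, m <= euler s u p.
Proof.
move=> mu p; have := @euler_le (fun=> m) u p mu.
by rewrite {1}/euler lap_cst mulr0 addr0.
Qed.

(* Jensen: the step is an average, and F lies above its tangent at the averaged value. *)
Lemma euler_energy b u m : 0 < m -> (forall q, m <= u q) ->
  \sum_p Fsp b (euler s u p) <= \sum_p Fsp b (u p).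
Proof.
move=> m0 mu.
(* A step preserves the total of any grid function, since [lap] has zero sum. *)
have -> : \sum_p Fsp b (u p) = \sum_p euler s (fun q => Fsp b (u q)) p.
  by rewrite [RHS]big_split /= -mulr_sumr sum_lap // mulr0 addr0.
apply: ler_sum => p _; set z := euler s u p.
have z0 : 0 < z := lt_le_trans m0 (euler_ge mu p).
have := @euler_le (fun q => (Fsp b z - (ln z + b) * z) + (ln z + b) * u q)
  (fun q => Fsp b (u q)) p.
rewrite euler_affine -/z subrK; apply=> q.
have u0 : 0 < u q := lt_le_trans m0 (mu q).
by have := Fsp_tangent b z0 u0; rewrite mulrBr; lra.
Qed.

Lemma iter_euler_stable b u m n : 0 < m -> (forall q, m <= u q) ->
  (forall q, m <= iter n (euler s) u q) /\
  \sum_p Fsp b (iter n (euler s) u p) <= \sum_p Fsp b (u p).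
Proof.
move=> m0 mu; elim: n => [//|n [IH1 IH2]]; split=> [|/=]; first exact: euler_ge.
exact: le_trans (euler_energy b m0 IH1) IH2.
Qed.

End stable_step.

(** A uniform lower bound [m > 0] passes to the limit, where mere positivity might be lost, and
    keeps the limit where [Fsp b] is continuous. *)
Lemma expLap_stable b a u m : 0 <= a -> 0 < m -> (forall q, m <= u q) ->
  (forall p, m <= expLap a u p) /\
  \sum_p Fsp b (expLap a u p) <= \sum_p Fsp b (u p).
Proof.
move=> a0 m0 mu.
have small : (\forall n \near \oo, (a / n%:R) * (6 / h2) <= 1)%classic.
  near=> n; have n0 : (0 < n)%N by near: n; exact: nbhs_infty_gt.
  rewrite mulrAC ler_pdivrMr ?ltr0n // mul1r.
  by near: n; exact: nbhs_infty_ger.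
have st n : a / n%:R * (6 / h2) <= 1 ->
  (forall q, m <= iter n (euler (a / n%:R)) u q) /\
  \sum_p Fsp b (iter n (euler (a / n%:R)) u p) <= \sum_p Fsp b (u p).
  by move=> hn; apply: iter_euler_stable => //; rewrite divr_ge0.
have ge p : m <= expLap a u p.
  apply: cvgr_to_ge (@cvg_iter_euler a u p a0) _.
  by apply: filterS small => n /st[].
split => //.
apply: (@cvgr_to_le _ (nbhs \oo%classic) _ _
  (fun n => \sum_p Fsp b (iter n (euler (a / n%:R)) u p))).
  apply: cvg_big => [|p _]; first exact: add_continuous.
  apply: (@cvg_comp _ _ _ (fun n => iter n (euler (a / n%:R)) u p) (Fsp b)).
    exact: cvg_iter_euler.
  have e0 : 0 < expLap a u p := lt_le_trans m0 (ge p).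
  apply: differentiable_continuous; apply/derivable1_diffP.
  by have [] := is_derive_Fsp b e0.
by apply: filterS small => n /st[].
Unshelve. all: by end_near.
Qed.

End heat_semigroup.

(** * Assembling the splitting step *)

Section steps.
Variables (R : realType) (N r : nat).
Hypothesis hr : (1 <= r < N)%N.
Variable sigma : 'I_N -> R.
Hypothesis sigma_lt0 : forall i : 'I_N, (i < r)%N -> sigma i < 0.
Hypothesis sigma_gt0 : forall i : 'I_N, (r <= i)%N -> 0 < sigma i.
Variables (U : 'I_N -> R) (km : R).
Hypothesis km_gt0 : 0 < km.

Lemma react_step_exists_unique tau (c : 'I_N -> R) : 0 < tau -> (forall i, 0 < c i) ->
  exists! cout, react_step r sigma U km tau c cout.
Proof.
move=> tau0 c0.
have [Rh [hRh uRh]] := react_pred_exists_unique hr sigma_lt0 sigma_gt0 U km_gt0 tau0 c0.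
have [x [hx ux]] := react_corr_exists_unique hr sigma_lt0 sigma_gt0 km_gt0 tau0 c0 hRh.
exists (cR sigma c x); split; first by exists Rh, x.
by move=> _ [Rh' [x' [/uRh <- [/ux <- ->]]]].
Qed.

Lemma react_step_energy tau (c cout : 'I_N -> R) : 0 < tau -> (forall i, 0 < c i) ->
  react_step r sigma U km tau c cout ->
  (forall i, 0 < cout i) /\ \sum_i Fsp (U i) (cout i) <= \sum_i Fsp (U i) (c i).
Proof.
move=> tau0 c0 [Rh [x [hRh [hx ->]]]]; split; first by case: hx.
have := Freac_le sigma_lt0 sigma_gt0 km_gt0 tau0 c0 hRh hx.
by rewrite !FreacE cR0.
Qed.

Variable N0 : nat.
Hypothesis N0_gt0 : (0 < N0)%N.
Implicit Types c : 'I_N -> pt N0 -> R.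

Lemma FhE c : Fh U c = hstep R N0 ^+ 3 * \sum_p \sum_i Fsp (U i) (c i p).
Proof.
rewrite /Fh /gdot; congr (_ * _); apply: eq_bigr => p _.
by rewrite mulr1; apply: eq_bigr => i _; rewrite /Fsp (mulrC (U i)).
Qed.

Lemma Fh_le c c' : \sum_p \sum_i Fsp (U i) (c i p) <= \sum_p \sum_i Fsp (U i) (c' i p) ->
  Fh U c <= Fh U c'.
Proof. by move=> le; rewrite !FhE ler_wpM2l // exprn_ge0 // ltW // hstep_gt0. Qed.

Lemma react_field_exists_unique tau c : 0 < tau -> (forall i p, 0 < c i p) ->
  exists! cout, react_field r sigma U km tau c cout.
Proof.
move=> tau0 c0.
have ex p := react_step_exists_unique tau0 (fun i => c0 i p).
have [v hv] := choice ex.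
exists (fun i p => v p i); split=> [p|cout hc]; first by have [] := hv p.
apply/funext => i; apply/funext => p.
by have [_ /(_ _ (hc p)) ->] := hv p.
Qed.

Lemma react_field_energy tau c cout : 0 < tau -> (forall i p, 0 < c i p) ->
  react_field r sigma U km tau c cout ->
  (forall i p, 0 < cout i p) /\ Fh U cout <= Fh U c.
Proof.
move=> tau0 c0 hc.
have H p := react_step_energy tau0 (fun i => c0 i p) (hc p).
split=> [i p|]; first by have [] := H p.
by apply: Fh_le; apply: ler_sum => p _; have [] := H p.
Qed.

Lemma diff_step_exists_unique (D : R -> R) (a tau : R) (rho : pt N0 -> R) :
  (forall x, 0 < x -> 0 < D x) -> 0 < tau -> (forall p, 0 < rho p) ->
  exists! rho', diff_step D a tau rho rho'.
Proof.
move=> D0 tau0 rho0.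
have [[d Dd]|nD] := pselect (D_const D).
  exists (expLap (d * tau) rho); split=> [|rho' [/(_ d Dd)-> //]].
  (* Two constants that represent [D] agree, as evaluation at 1 shows. *)
  split=> [d' Dd'|]; first by rewrite -(Dd 1) // (Dd' 1).
  by case; exists d.
have [rhoh [hh uh]] := diff_pred_exists_unique N0_gt0 D0 tau0 rho0.
have [rho' [hr' ur']] := diff_corr_exists_unique a N0_gt0 D0 tau0 rho0 hh.
exists rho'; split.
  by split=> [d Dd|_]; [case: nD; exists d | exists rhoh].
by move=> rho'' [_ /(_ nD)[rhoh' [/uh <- /ur']]].
Qed.

Lemma diff_step_energy (D : R -> R) (a tau : R) (rho rho' : pt N0 -> R) :
  (forall x, 0 < x -> 0 < D x) -> 0 < tau -> (forall p, 0 < rho p) ->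
  diff_step D a tau rho rho' ->
  (forall p, 0 < rho' p) /\ \sum_p Fsp a (rho' p) <= \sum_p Fsp a (rho p).
Proof.
move=> D0 tau0 rho0 [hconst hvar].
have [[d Dd]|nD] := pselect (D_const D).
  have [p hp] := exists_min N0_gt0 rho.
  have d0 : 0 <= d * tau by rewrite mulr_ge0 ?(ltW tau0) // -(Dd 1) // ltW // D0.
  have [h1 h2] := expLap_stable N0_gt0 a d0 (rho0 p) hp.
  by rewrite (hconst d Dd); split => // q; apply: lt_le_trans (h1 q).
have [rhoh [hh hc]] := hvar nD.
by split; [case: hc | exact: (diff_corr_energy N0_gt0 D0 tau0 rho0 hh hc)].
Qed.

Variables (D : 'I_N -> R -> R) (dt : R).
Hypothesis D_gt0 : forall i x, 0 < x -> 0 < D i x.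
Hypothesis dt_gt0 : 0 < dt.

Let dt2_gt0 : 0 < dt / 2.
Proof. by rewrite divr_gt0. Qed.

(** Each stage is uniquely solvable for positive input, which the positivity of the preceding stage
    provides. *)
Lemma split_step_exists_unique c : (forall i p, 0 < c i p) ->
  exists! cnext, split_step r sigma U km D dt c cnext.
Proof.
move=> c0.
have [c1 [h1 u1]] := react_field_exists_unique dt2_gt0 c0.
have [p1 _] := react_field_energy dt2_gt0 c0 h1.
have ex i := diff_step_exists_unique (U i) (@D_gt0 i) dt_gt0 (p1 i).
have [c2 h2] := choice ex.
have p2 i p : 0 < c2 i p.
  by have [+ _] := diff_step_energy (@D_gt0 i) dt_gt0 (p1 i) (h2 i).1; apply.
have [c3 [h3 u3]] := react_field_exists_unique dt2_gt0 p2.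
exists c3; split.
  by exists c1, c2; split => //; split => // i; have [] := h2 i.
move=> c3' [c1' [c2' [/u1 <- [h2' h3']]]]; apply: u3.
by rewrite (_ : c2 = c2') //; apply/funext => i; exact: (h2 i).2.
Qed.

Lemma split_step_energy c cnext : (forall i p, 0 < c i p) ->
  split_step r sigma U km D dt c cnext ->
  (forall i p, 0 < cnext i p) /\ Fh U cnext <= Fh U c.
Proof.
move=> c0 [c1 [c2 [h1 [h2 h3]]]].
have [p1 e1] := react_field_energy dt2_gt0 c0 h1.
have H i := diff_step_energy (@D_gt0 i) dt_gt0 (p1 i) (h2 i).
have [p3 e3] := react_field_energy dt2_gt0 (fun i => (H i).1) h3.
split => //; apply: (le_trans e3); apply: le_trans e1; apply: Fh_le.
(* Diffusion dissipates energy species by species, so the sum over species goes outside. *)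
rewrite exchange_big [leRHS]exchange_big /=.
by apply: ler_sum => i _; exact: (H i).2.
Qed.

End steps.

Theorem theorem3p7 (R : realType) (N r : nat) (hr : (1 <= r < N)%N)
  (sigma : 'I_N -> R)
  (hsig_react : forall i : 'I_N, (i < r)%N -> sigma i < 0)
  (hsig_prod : forall i : 'I_N, (r <= i)%N -> 0 < sigma i)
  (U : 'I_N -> R) (km : R) (hkm : 0 < km)
  (D : 'I_N -> R -> R) (hD : forall i x, 0 < x -> 0 < D i x)
  (N0 : nat) (hN0 : (0 < N0)%N) (dt : R) (hdt : 0 < dt) :
  (* unique solvability of each sub-scheme *)
  (forall tau (c0 : 'I_N -> R), 0 < tau -> (forall i, 0 < c0 i) ->
     (exists! Rh, react_pred r sigma U km tau c0 Rh) /\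
     (forall Rh, react_pred r sigma U km tau c0 Rh ->
        exists! x, react_corr r sigma U km tau c0 Rh x)) /\
  (forall i tau (rho : pt N0 -> R), 0 < tau -> (forall p, 0 < rho p) -> ~ D_const (D i) ->
     (exists! rhoh, diff_pred (D i) tau rho rhoh) /\
     (forall rhoh, diff_pred (D i) tau rho rhoh ->
        exists! rho', diff_corr (D i) (U i) tau rho rhoh rho')) /\
  (* one splitting step: unique solution, positivity, energy decay *)
  (forall c : 'I_N -> pt N0 -> R, (forall i p, 0 < c i p) ->
     (exists! cnext, split_step r sigma U km D dt c cnext) /\
     (forall cnext, split_step r sigma U km D dt c cnext ->
        (forall i p, 0 < cnext i p) /\ Fh U cnext <= Fh U c)) /\
  (* energy bound along the whole sequence *)
  (forall cs : nat -> 'I_N -> pt N0 -> R, (forall i p, 0 < cs 0%N i p) ->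
     (forall n, split_step r sigma U km D dt (cs n) (cs n.+1)) ->
     forall n, Fh U (cs n) <= Fh U (cs 0%N)).
Proof.
split=> [tau c0 tau0 c0_gt0|].
  split=> [|Rh hRh]; first exact: react_pred_exists_unique.
  exact: react_corr_exists_unique hRh.
split=> [i tau rho tau0 rho0 _|].
  split=> [|rhoh hh]; first exact: (diff_pred_exists_unique hN0 (hD i)).
  exact: (diff_corr_exists_unique (U i) hN0 (hD i) tau0 rho0 hh).
split=> [c c_gt0|cs cs0 hcs n].
  split=> [|cnext hc]; first exact: split_step_exists_unique.
  exact: split_step_energy hc.
have step c cnext := @split_step_energy R N r sigma hsig_react hsig_prod U km hkm
  N0 hN0 D dt hD hdt c cnext.
(* Positivity is carried through the induction because the one-step estimate is for positive
   data. *)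
suff [] : (forall i p, 0 < cs n i p) /\ Fh U (cs n) <= Fh U (cs 0%N) by [].
elim: n => [|n [pn en]]; first by [].
have [pS eS] := step _ _ pn (hcs n).
by split => //; apply: le_trans en.
Qed.
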